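(* Let $T_0$ be any initial BST on $\{1,\dots,n\}$. For every $n\ge 2$ there exist query sequences $X\in[n]^m$ such that $$\mathrm{cost}(GF,X,T_0)-\mathrm{cost}(OPT,X,T_0)=\Omega(m\cdot\lg\lg n),$$ where the constant hidden in $\Omega$ is independent of $n$ and $m$. Among these sequences there is one whose length is $m=n^{\Theta(\lg\lg n/\lg\lg\lg n)}$.
   Context: $\lg$ is the base-2 logarithm. Binary search tree model. Keys are $\{1,\dots,n\}$. A query sequence is $X=[x_1,\dots,x_m]\in[n]^m$ and $T_0$ is an initial binary search tree (BST) on the keys. An algorithm $A$ serves $x_1,\dots,x_m$ in order. Before serving $x_t$ it holds a BST $T_{t-1}$; it searches $x_t$ from the root and may then restructure the tree by rotations into $T_t$. Let $P_t$ be the set of nodes on the root-to-$x_t$ path of $T_{t-1}$, and let $U_t$ be the node set of the minimal subtree containing all edges rotated in transforming $T_{t-1}$ into $T_t$. The cost at time $t$ is $|P_t\cup U_t|$. $\mathrm{cost}(A,X,T_0)$ is the sum of these costs over $t=1,\dots,m$. $OPT$ denotes an algorithm of minimum cost on $(X,T_0)$ that knows all of $X$ in advance. Greedy Future ($GF$). After finding $x_t$ in $T_{t-1}$, let $v_1<\dots<v_k$ be the keys on the root-to-$x_t$ path, set $v_0=-\infty$ and $v_{k+1}=+\infty$, and let $R_0,\dots,R_k$ be the subtrees hanging off this path. For each $i$, $\tau(v_i)$ is the smallest $s>t$ with $x_s\in(v_{i-1},v_{i+1})$, or $+\infty$ if there is none. $GF$ rearranges $v_1,\dots,v_k$ as a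 treap: a BST in key order and a heap in $\tau$, with the smallest $\tau$ at the top. Ties in $\tau$ are broken in favor of the node of smaller depth in $T_{t-1}$. It then reattaches $R_0,\dots,R_k$ unchanged at their unique positions, giving $T_t$. *)

(* Defs.v *)
From mathcomp Require Import all_boot.
From Stdlib Require Import Reals.
Set Implicit Arguments. Unset Strict Implicit. Unset Printing Implicit Defensive.

Inductive tree := Leaf | Node of tree & nat & tree.

Fixpoint inorder (t : tree) : seq nat :=
  match t with Leaf => [::] | Node l k r => inorder l ++ k :: inorder r end.

Definition is_bst (n : nat) (t : tree) : Prop := inorder t = iota 1 n.

Fixpoint search_path (x : nat) (t : tree) : seq nat :=
  match t with
  | Leaf => [::]
  | Node l k r =>
      k :: (if x == k then [::]
            else if x < k then search_path x l else search_path x r)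
  end.

(* Given a key set U, the "top region" of t is the connected subtree of
   U-nodes containing the root.  topkeys = its keys in key order,
   hang = the subtrees hanging off it, in key order (empty ones = Leaf). *)
Fixpoint topkeys (U : pred nat) (t : tree) : seq nat :=
  match t with
  | Leaf => [::]
  | Node l k r => if U k then topkeys U l ++ k :: topkeys U r else [::]
  end.

Fixpoint hang (U : pred nat) (t : tree) : seq tree :=
  match t with
  | Leaf => [:: Leaf]
  | Node l k r => if U k then hang U l ++ hang U r else [:: t]
  end.

(* restructure A B S : B is obtained from A by rotations confined to the
   connected subtree of A with node set S (S = [::] : no rotation at all).
   Equivalently: some connected subtree S of A (anywhere in A) is replaced by
   another BST on the same keys, with the hanging subtrees reattached
   unchanged. *)
Inductive restructure : tree -> tree -> seq nat -> Prop :=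
| rs_none A : restructure A A [::]
| rs_top (U : pred nat) l k r B :
    U k ->
    topkeys U B = topkeys U (Node l k r) ->
    hang U B = hang U (Node l k r) ->
    restructure (Node l k r) B (topkeys U (Node l k r))
| rs_left l l' k r Us :
    restructure l l' Us -> restructure (Node l k r) (Node l' k r) Us
| rs_right l k r r' Us :
    restructure r r' Us -> restructure (Node l k r) (Node l k r') Us.

Fixpoint valid_exec (T : tree) (X : seq nat) (E : seq (tree * seq nat)) : Prop :=
  match X, E with
  | [::], [::] => True
  | _ :: X', (T', Us) :: E' => restructure T T' Us /\ valid_exec T' X' E'
  | _, _ => False
  end.

Fixpoint exec_cost (T : tree) (X : seq nat) (E : seq (tree * seq nat)) : nat :=
  match X, E with
  | x :: X', (T', Us) :: E' =>
      size (undup (search_path x T ++ Us)) + exec_cost T' X' E'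
  | _, _ => 0
  end.

Definition is_opt_cost (T0 : tree) (X : seq nat) (c : nat) : Prop :=
  (exists E, valid_exec T0 X E /\ exec_cost T0 X E = c) /\
  (forall E, valid_exec T0 X E -> c <= exec_cost T0 X E).

Definition in_open (lo hi : option nat) (x : nat) : bool :=
  (if lo is Some a then a < x else true) && (if hi is Some b then x < b else true).

(* tau for current (0-based) time i: first s > i with x_s in (lo,hi);
   "+infinity" is represented by size X, larger than every real index. *)
Definition tau (X : seq nat) (i : nat) (lo hi : option nat) : nat :=
  i.+1 + find (in_open lo hi) (drop i.+1 X).

(* lexicographic order on (tau, depth): smaller goes higher *)
Definition prio_lt (a b : nat * nat) : bool :=
  (a.1 < b.1) || ((a.1 == b.1) && (a.2 < b.2)).

Fixpoint min_index_aux (ps : seq (nat * nat)) (j best : nat) (bp : nat * nat) : nat :=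
  match ps with
  | [::] => best
  | p :: ps' => if prio_lt p bp then min_index_aux ps' j.+1 j p
                else min_index_aux ps' j.+1 best bp
  end.

Definition min_index (ps : seq (nat * nat)) : nat :=
  if ps is p :: ps' then min_index_aux ps' 1 0 p else 0.

(* treap on keys ks (sorted, with priorities), hanging subtrees hs
   (size hs = size ks + 1) reattached at their unique positions *)
Fixpoint build (fuel : nat) (ks : seq (nat * (nat * nat))) (hs : seq tree) : tree :=
  match fuel with
  | 0 => head Leaf hs
  | fuel'.+1 =>
      match ks with
      | [::] => head Leaf hs
      | _ =>
        let i := min_index (map snd ks) in
        Node (build fuel' (take i ks) (take i.+1 hs))
             (nth 0 (map fst ks) i)
             (build fuel' (drop i.+1 ks) (drop i.+1 hs))
      end
  end.

Definition gf_step (X : seq nat) (i : nat) (T : tree) : tree :=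
  let x := nth 0 X i in
  let P := search_path x T in
  let U := fun k => k \in P in
  let vs := topkeys U T in
  let hs := hang U T in
  let K := size vs in
  let lo j := if j == 0 then None else Some (nth 0 vs j.-1) in
  let hi j := if j.+1 == K then None else Some (nth 0 vs j.+1) in
  let items := [seq (nth 0 vs j, (tau X i (lo j) (hi j), index (nth 0 vs j) P))
               | j <- iota 0 K] in
  build K items hs.

(* cost of GF: GF only rotates edges of the search path, so U_t is contained
   in P_t and |P_t \cup U_t| = |P_t|. *)
Fixpoint gf_run (X : seq nat) (i : nat) (T : tree) (rest : seq nat) : nat :=
  match rest with
  | [::] => 0
  | x :: rest' => size (search_path x T) + gf_run X i.+1 (gf_step X i T) rest'
  end.

Definition gf_cost (X : seq nat) (T0 : tree) : nat := gf_run X 0 T0 X.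

Definition lg (x : R) : R := Rdiv (ln x) (ln (IZR 2)).

(* Main.v *)
Require Import Defs.
From mathcomp Require Import all_boot.
From Stdlib Require Import Reals.
From Stdlib Require Import Lra ZArith Classical.
From mathcomp Require Import ssrnat zify.
Set Implicit Arguments. Unset Strict Implicit. Unset Printing Implicit Defensive.

(** If [f p] is the last time at which [p] was on a search path, the path to [x]
    consists of the keys [p] visible from [x]: every key strictly closer to [x]
    (and [x] itself) was touched strictly earlier than [p]. So Greedy Future is
    the online process [step].

    Put four separators [s1 < s2 < s3 < s4] around five groups and visit the
    groups 0, 1, 4, 3 cyclically. Each time a group is revisited both its
    neighbouring separators have been touched since, so a block and its groups
    evolve independently of each other and the construction can be nested. In
    the cycle entered after suitable initial queries to the separators, Greedy
    touches 3, 2, 3, 2 separators, while the static tree with root [s2] and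
    children [s1] and [s4] (with [s3] below [s4]) has depths 2, 2, 2, 3. Greedy
    thus loses 1 per four queries on each level, and there are about [lg n]
    nested levels; the gap obtained is even of order [m lg n]. *)

(** * Greedy Future as a process on touch times *)

Definition vis (f : nat -> nat) (x p : nat) : bool :=
  all (fun q => f q < f p) (iota p.+1 (x - p) ++ iota x (p - x)).

Definition step (f : nat -> nat) (t x : nat) : nat -> nat :=
  fun p => if vis f x p then t else f p.

Lemma visP f x p :
  reflect (forall q, (p < q <= x) || (x <= q < p) -> f q < f p) (vis f x p).
Proof.
apply: (iffP allP) => H q Hq; apply: H; move: Hq; rewrite mem_cat !mem_iota; lia.
Qed.

Lemma vis_refl f x : vis f x x.
Proof. by apply/visP => q; lia. Qed.

Lemma visN f x p q : (p < q <= x) || (x <= q < p) -> f p <= f q -> vis f x p = false.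
Proof. by move=> Hq le_pq; apply/negP => /visP /(_ q Hq); rewrite ltnNge le_pq. Qed.

Lemma eq_vis f f' x p :
  (forall q, (p <= q <= x) || (x <= q <= p) -> f q = f' q) -> vis f x p = vis f' x p.
Proof.
move=> eq_f; apply: eq_in_all => q; rewrite mem_cat !mem_iota => Hq.
by rewrite !eq_f //; lia.
Qed.

Lemma step_le f t x p : (forall q, f q < t) -> step f t x p <= t.
Proof. by move=> lt_ft; rewrite /step; case: ifP => // _; apply: ltnW. Qed.

Fixpoint greedy_cost (n : nat) (f : nat -> nat) (t : nat) (xs : seq nat) : nat :=
  if xs is x :: xs' then count (vis f x) (iota 1 n) + greedy_cost n (step f t x) t.+1 xs'
  else 0.

(** The root has a latest touch time, and among ties it is one that the next query to the interval
    can see; this second clause records how Greedy Future arranges keys touched together. Both [lo]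
    and [hi] are exclusive, and a leaf spans an empty interval, so no key is missing. *)
Fixpoint tree_inv (f : nat -> nat) (rest : seq nat) (lo hi : nat) (T : tree) : Prop :=
  match T with
  | Leaf => hi <= lo.+1
  | Node l k r =>
      [/\ lo < k < hi, forall q, lo < q < hi -> f q <= f k,
          forall y, ohead [seq y <- rest | lo < y < hi] = Some y -> vis f y k,
          tree_inv f rest lo k l & tree_inv f rest k hi r]
  end.

Lemma search_path_range f rest lo hi T x :
  tree_inv f rest lo hi T -> {subset search_path x T <= [pred p | lo < p < hi]}.
Proof.
elim: T lo hi => [|l IHl k r IHr] lo hi //= [Hk _ _ Hl Hr] p.
rewrite inE => /predU1P [->|]; first by rewrite inE.
case: eqP => // _; case: ifP => _.
- by move=> /(IHl _ _ Hl); rewrite !inE; lia.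
- by move=> /(IHr _ _ Hr); rewrite !inE; lia.
Qed.

(** The root is visible from [x] by the invariant and hides every key beyond it, since none is more
    recent. The claim then recurses into the side of [x]. *)
Lemma search_path_vis f x rest lo hi T :
  tree_inv f (x :: rest) lo hi T -> lo < x < hi ->
  forall p, lo < p < hi -> (p \in search_path x T) = vis f x p.
Proof.
elim: T lo hi => [|l IHl k r IHr] lo hi /=; first by lia.
rewrite /=; case=> Hk Hle Hy Hl Hr Hx p Hp.
have visk : vis f x k by apply: Hy; rewrite Hx.
rewrite inE; case: (eqVneq p k) => [->|neq_pk] /=; first by rewrite visk.
case: (ltngtP x k) => [lt_xk|lt_kx|eq_xk].
- case: (ltnP p k) => [lt_pk|le_kp].
    by apply: (IHl _ _ Hl); lia.
  rewrite (@visN _ _ _ k) ?Hle //; last by lia.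
  by apply/negP => /(search_path_range Hl); rewrite inE; lia.
- case: (ltnP p k) => [lt_pk|le_kp].
    rewrite (@visN _ _ _ k) ?Hle //; last by lia.
    by apply/negP => /(search_path_range Hr); rewrite inE; lia.
  by apply: (IHr _ _ Hr); lia.
- rewrite eq_xk; rewrite (@visN _ _ _ k) ?Hle //; lia.
Qed.

(** A query outside the interval does not change which query comes next inside it, and visibility
    between two points reads [f] only between them. *)
Lemma eq_tree_inv f f' x rest lo hi T :
  (forall q, lo < q < hi -> f q = f' q) -> ~~ (lo < x < hi) ->
  tree_inv f (x :: rest) lo hi T -> tree_inv f' rest lo hi T.
Proof.
elim: T lo hi => [|l IHl k r IHr] lo hi // eq_f Hx [Hk Hle Hy Hl Hr]; split => //.
- by move=> q Hq; rewrite -!eq_f // Hle.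
- move=> y Hyy; rewrite -(@eq_vis f); first by apply: Hy; rewrite /= (negPf Hx).
  have : y \in [seq y <- rest | lo < y < hi].
    by case: [seq _ <- _ | _] Hyy => [|z s] //= [->]; rewrite mem_head.
  by rewrite mem_filter => /andP [Hyr _] q Hq; apply: eq_f; lia.
- by apply: IHl Hl => [q Hq|]; [apply: eq_f|]; lia.
- by apply: IHr Hr => [q Hq|]; [apply: eq_f|]; lia.
Qed.

(** The shape just after a search at time [t]: the path keys [vs] carry time [t], and the hanging
    trees [hs] fill the gaps between them with strictly older keys. *)
Fixpoint chain (f : nat -> nat) (t : nat) (rest : seq nat) lo hi (vs : seq nat) (hs : seq tree) : Prop :=
  match vs, hs with
  | [::], [:: h] => tree_inv f rest lo hi h /\ forall q, lo < q < hi -> f q < t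
  | v :: vs', h :: hs' =>
     [/\ lo < v < hi, tree_inv f rest lo v h, forall q, lo < q < v -> f q < t, f v = t &
         chain f t rest v hi vs' hs']
  | _, _ => False
  end.

Lemma chain_cat f t rest lo k hi vs1 hs1 vs2 hs2 :
  lo < k < hi -> f k = t ->
  chain f t rest lo k vs1 hs1 -> chain f t rest k hi vs2 hs2 ->
  chain f t rest lo hi (vs1 ++ k :: vs2) (hs1 ++ hs2).
Proof.
elim: vs1 lo hs1 => [|v vs1 IH] lo [|h hs1] //=.
  by case: hs1 => // Hk Hfk [Hh Hq] H2; split.
move=> Hk Hfk [Hv Hh Hq Hfv H1] H2; split => //; first by lia.
by apply: IH => //; lia.
Qed.

Lemma chain_split f t rest lo hi vs hs i :
  i < size vs -> chain f t rest lo hi vs hs ->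
  let v := nth 0 vs i in
  [/\ lo < v < hi, f v = t, chain f t rest lo v (take i vs) (take i.+1 hs) &
      chain f t rest v hi (drop i.+1 vs) (drop i.+1 hs)].
Proof.
elim: i lo vs hs => [|i IH] lo [|v vs] [|h hs] //= lt_i [Hv Hh Hq Hfv H].
  by rewrite !take0 !drop0; split => //; split.
have [Hv' Hf' H1 H2] := IH v vs hs lt_i H.
have E : v < nth 0 vs i < hi by lia.
split => //; first by lia.
by split => //; lia.
Qed.

(** [U] is the search path while [x] lies in the interval and is empty otherwise. A nonempty hanging
    tree starts where [x] has left the interval, so its invariant passes from [x :: rest] to [rest]
    by [eq_tree_inv]. *)
Lemma chain_topkeys f f' t x rest U lo hi T :
  (forall q, lo < q < hi -> f q < t) ->
  (forall q, lo < q < hi -> U q = (lo < x < hi) && (q \in search_path x T)) ->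
  (forall q, lo < q < hi -> f' q = if U q then t else f q) ->
  tree_inv f (x :: rest) lo hi T ->
  chain f' t rest lo hi (topkeys U T) (hang U T).
Proof.
elim: T lo hi => [|l IHl k r IHr] lo hi Hlt HU Hf'.
  by move=> /= H; split => // q; lia.
move=> H; have H' := H; case: H => Hk Hle Hy Hl Hr.
have HUk : U k = (lo < x < hi).
  by rewrite HU //= mem_head andbT.
rewrite [topkeys _ _]/= [hang _ _]/=; case: ifP => Uk; last first.
  have Hx : (lo < x < hi) = false by rewrite -HUk.
  have HUf q : lo < q < hi -> U q = false by move=> Hq; rewrite HU // Hx.
  have eq_f q : lo < q < hi -> f q = f' q by move=> Hq; rewrite Hf' // HUf.
  split=> [|q Hq]; last by rewrite -eq_f // Hlt.
  by apply: eq_tree_inv H' => //; rewrite Hx.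
have Hx : lo < x < hi by rewrite -HUk.
apply: chain_cat => //; first by rewrite Hf' // Uk.
- apply: IHl => // [q Hq|q Hq|q Hq]; [by apply: Hlt; lia| |by apply: Hf'; lia].
  rewrite HU; last lia; rewrite Hx /= inE.
  have -> : (q == k) = false by lia.
  have Nr : (q \in search_path x r) = false.
    by apply/negP => /(search_path_range Hr); rewrite inE; lia.
  case: (ltngtP x k) => [lt_xk|lt_kx|->] //=.
  + by have -> : lo < x by lia.
  + by rewrite Nr andbF.
  + by rewrite andbF.
- apply: IHr => // [q Hq|q Hq|q Hq]; [by apply: Hlt; lia| |by apply: Hf'; lia].
  rewrite HU; last lia; rewrite Hx /= inE.
  have -> : (q == k) = false by lia.
  have Nl : (q \in search_path x l) = false.
    by apply/negP => /(search_path_range Hl); rewrite inE; lia.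
  case: (ltngtP x k) => [lt_xk|lt_kx|->] //=.
  by have -> : x < hi by lia.
Qed.

(** The first components are the values of [tau], with [base] the time of the head of [rest] and
    finite sentinels [lo], [hi] for the infinite ends. *)
Fixpoint next_query_ok (rest : seq nat) base lo hi (ks : seq (nat * (nat * nat))) : Prop :=
  if ks is (v, (tv, _)) :: ks' then
    tv = base + find (fun y => lo < y < head hi (unzip1 ks')) rest /\
    next_query_ok rest base v hi ks'
  else True.

Lemma next_query_ok_split rest base lo hi ks i :
  i < size ks -> next_query_ok rest base lo hi ks ->
  let v := nth 0 (unzip1 ks) i in
  [/\ (nth (0, 0) (unzip2 ks) i).1 =
      base + find (fun y => last lo (take i (unzip1 ks)) < y < head hi (drop i.+1 (unzip1 ks))) rest,
      next_query_ok rest base lo v (take i ks) &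
      next_query_ok rest base v hi (drop i.+1 ks)].
Proof.
elim: i lo ks => [|i IH] lo [|[v [tv d]] ks] //=.
  by rewrite !drop0 => _ [-> H].
move=> lt_i [Htv H]; have [E H1 H2] := IH v ks lt_i H.
split => //; split => //; rewrite Htv; congr (_ + find _ rest).
by case: ks lt_i {IH Htv H E H1 H2} => [|[w p] ks] //; case: i.
Qed.

(* Wherever [y] falls between the keys of the chain, one of its two neighbours
   is a key whose priority is at most the time of [y]. *)
Lemma next_query_le f t rest base lo hi ks hs F :
  chain f t rest lo hi (unzip1 ks) hs -> next_query_ok rest base lo hi ks ->
  0 < size ks -> lo < nth 0 rest F < hi -> F < size rest ->
  exists2 p, p \in unzip2 ks & p.1 <= base + F.
Proof.
elim: ks lo hs => [|[v [tv d]] ks IH] lo [|h hs] //= [Hv _ _ _ Hc] [Htv Hn] _ Hy HF.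
case: (ltnP (nth 0 rest F) (head hi (unzip1 ks))) => Hy2.
  exists (tv, d); rewrite ?mem_head //= Htv leq_add2l leqNgt.
  by apply/negP => /(before_find 0) /=; rewrite Hy2; lia.
have sz : 0 < size ks by case: ks Hy2 {IH Hc Hn Htv} => //=; lia.
have Hy3 : v < nth 0 rest F < hi.
  case: ks sz Hy2 Hc {IH Hn Htv} => [|[w p] ks] //= _ Hw.
  by case: hs => //= ? ? [Hvw _ _ _ _]; lia.
have [p Hp Hle] := IH v hs Hc Hn sz Hy3 HF.
by exists p => //; rewrite inE Hp orbT.
Qed.

Lemma min_index_auxP ps j best bp :
  let i := min_index_aux ps j best bp in
  (i = best /\ all (fun p => bp.1 <= p.1) ps) \/
  [/\ j <= i < j + size ps, (nth bp ps (i - j)).1 <= bp.1 &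
      all (fun p => (nth bp ps (i - j)).1 <= p.1) ps].
Proof.
elim: ps j best bp => [|p ps IH] j best bp /=; first by left.
case: ifP => Hp.
  have le_p : p.1 <= bp.1 by move: Hp; rewrite /prio_lt; lia.
  case: (IH j.+1 j p) => [[-> Hall]|[Hi Hle Hall]]; right.
    by rewrite subnn /=; split; rewrite ?leqnn //; lia.
  set i := min_index_aux _ _ _ _ in Hi Hle Hall *.
  have E : i - j = (i - j.+1).+1 by lia.
  rewrite E /= (set_nth_default p); last by lia.
  by split; [lia | lia | rewrite Hle].
have le_p : bp.1 <= p.1 by move: Hp; rewrite /prio_lt; lia.
case: (IH j.+1 best bp) => [[-> Hall]|[Hi Hle Hall]]; first by left; rewrite le_p.
set i := min_index_aux _ _ _ _ in Hi Hle Hall *.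
have E : i - j = (i - j.+1).+1 by lia.
right; rewrite E /=; split; [lia | lia | by rewrite Hall andbT; lia].
Qed.

Lemma min_indexP ps : 0 < size ps ->
  min_index ps < size ps /\
  forall p, p \in ps -> (nth (0, 0) ps (min_index ps)).1 <= p.1.
Proof.
case: ps => [|p ps] //= _.
case: (min_index_auxP ps 1 0 p) => [[-> Hall]|[Hi Hle Hall]].
  by split=> // q; rewrite inE => /predU1P [->|/(allP Hall)].
set i := min_index_aux _ _ _ _ in Hi Hle Hall *.
have E : i = (i - 1).+1 by lia.
have En : nth (0, 0) (p :: ps) i = nth p ps (i - 1).
  by rewrite {1}E /=; apply: set_nth_default; lia.
rewrite En; split; first by lia.
by move=> q; rewrite inE => /predU1P [->|/(allP Hall)].
Qed.

Lemma chain_head f t rest lo hi vs hs q :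
  chain f t rest lo hi vs hs -> lo < q < head hi vs -> f q < t.
Proof. by case: vs hs => [|v vs] [|h [|h' hs]] //= [] // *; auto. Qed.

Lemma chain_last f t rest lo hi vs hs q :
  chain f t rest lo hi vs hs -> last lo vs < q < hi -> f q < t.
Proof.
elim: vs lo hs => [|v vs IH] lo [|h hs] //=.
  by case: hs => // [[]] _; apply.
by case=> _ _ _ _; apply: IH.
Qed.

Lemma chain_bounds f t rest lo hi vs hs :
  chain f t rest lo hi vs hs -> lo < hi -> lo <= last lo vs < hi /\ lo < head hi vs <= hi.
Proof.
move=> H lt_lo; split; last first.
  by case: vs hs H => [|v vs] [|h hs] //=; [case: hs; lia | case; lia].
elim: vs lo hs H lt_lo => [|v vs IH] lo [|h hs] //=.
  by case: hs => // _; lia.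
by case=> Hv _ _ _ /IH IHv; have := IHv; lia.
Qed.

(** Let the next query [y] to the interval have index [F]. By [next_query_le] the least priority is
    at most [base + F]. The gap between the chain neighbours of the chosen root [v] lies inside the
    interval, so its first query cannot precede [F] and is [y] itself. All keys other than [v] in
    this gap are older than [v], so [v] is visible from [y]. *)
Lemma tree_inv_build f t rest base fuel lo hi ks hs :
  (forall q, f q <= t) -> size ks <= fuel -> lo < hi ->
  chain f t rest lo hi (unzip1 ks) hs -> next_query_ok rest base lo hi ks ->
  tree_inv f rest lo hi (build fuel ks hs).
Proof.
move=> le_ft; elim: fuel lo hi ks hs => [|fuel IH] lo hi ks hs.
  by rewrite leqn0 size_eq0 => /eqP -> /= _; case: hs => [|h [|]] // [].
case: ks => [|e ks']; first by move=> /= _ _; case: hs => [|h [|]] // [].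
set ks := e :: ks' => sz lt_lo Hc Hn.
have -> : build fuel.+1 ks hs =
  let i := min_index (unzip2 ks) in
  Node (build fuel (take i ks) (take i.+1 hs)) (nth 0 (unzip1 ks) i)
       (build fuel (drop i.+1 ks) (drop i.+1 hs)) by [].
have [] := @min_indexP (unzip2 ks) _; first by rewrite size_map.
set i := min_index _; rewrite size_map => lt_i Hmin.
have lt_i' : i < size (unzip1 ks) by rewrite size_map.
have [Hv Hfv Hc1 Hc2] := chain_split lt_i' Hc.
have [Htau Hn1 Hn2] := next_query_ok_split lt_i Hn.
set v := nth 0 _ i in Hv Hfv Hc1 Hc2 Hn1 Hn2 *.
rewrite /= -[nth 0 (e.1 :: _) i]/v; split => //.
- by move=> q _; rewrite Hfv.
- move=> y Hy.
  set F := find (fun y => lo < y < hi) rest.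
  have [HF ->] : F < size rest /\ y = nth 0 rest F.
    rewrite /F; elim: (rest) Hy => [|z s IHs] //=.
    by case: ifP => _ //= [->].
  have Hyr : lo < nth 0 rest F < hi by apply: (nth_find 0 (a := fun y => lo < y < hi)); rewrite has_find.
  have [|p Hp Hle] := next_query_le Hc Hn _ Hyr HF; first by [].
  have := leq_trans (Hmin _ Hp) Hle; rewrite Htau leq_add2l => HF'.
  set F' := find _ _ in HF'.
  have [b1 b1'] := chain_bounds Hc1 (proj1 (andP Hv)).
  have [b2' b2] := chain_bounds Hc2 (proj2 (andP Hv)).
  set a := last lo _ in F' HF' b1 *; set b := head hi _ in F' HF' b2 *.
  have HaF : a < nth 0 rest F' < b.
    by apply: (nth_find 0 (a := fun y => a < y < b)); rewrite has_find; apply: leq_ltn_trans HF.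
  have EF : F' = F.
    apply/eqP; rewrite eqn_leq HF' leqNgt; apply/negP => /(before_find 0) /=; lia.
  rewrite EF in HaF; apply/visP => q Hq; rewrite Hfv.
  case: (ltnP q v) => lt_qv.
    by apply: (chain_last Hc1); rewrite -/a; lia.
  by apply: (chain_head Hc2); rewrite -/b; lia.
- apply: IH Hn1; rewrite ?/unzip1 ?map_take //; last by case/andP: Hv.
  by rewrite size_take lt_i; move: sz lt_i; clear; rewrite /ks /=; lia.
- apply: IH Hn2; rewrite ?/unzip1 ?map_drop //; last by case/andP: Hv.
  by rewrite size_drop; move: sz lt_i; clear; rewrite /ks /=; lia.
Qed.

(** Queries lie between 1 and [n], so the sentinels 0 and [n.+1] admit the same queries as [None]
    does. *)
Lemma next_query_ok_tau X i n vs (d : nat -> nat) m j :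
  {in drop i.+1 X, forall y, 0 < y < n.+1} -> j + m = size vs ->
  next_query_ok (drop i.+1 X) i.+1 (if j == 0 then 0 else nth 0 vs j.-1) n.+1
    [seq (nth 0 vs k,
          (tau X i (if k == 0 then None else Some (nth 0 vs k.-1))
                   (if k.+1 == size vs then None else Some (nth 0 vs k.+1)), d k))
    | k <- iota j m].
Proof.
move=> HX; elim: m j => [|m IH] j Hj //=; split; last first.
  by have := IH j.+1; rewrite addSnnS Hj; apply.
rewrite /tau; congr (_ + _); apply: eq_in_find => y /HX Hy.
rewrite /in_open; congr (_ && _); first by case: (j == 0) => //; case/andP: Hy => ->.
case: m Hj {IH} => [|m] Hj /=.
  by rewrite -Hj addn1 eqxx; case/andP: Hy => _ ->.
by have -> : (j.+1 == size vs) = false by lia.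
Qed.

Lemma tree_inv_gf_step f t n X i T :
  {in X, forall y, 0 < y < n.+1} -> i < size X -> (forall q, f q < t) ->
  tree_inv f (drop i X) 0 n.+1 T ->
  tree_inv (step f t (nth 0 X i)) (drop i.+1 X) 0 n.+1 (gf_step X i T).
Proof.
move=> HX lt_i lt_ft; rewrite (drop_nth 0) //; set x := nth 0 X i => HT.
have Hx : 0 < x < n.+1 by apply: HX; apply: mem_nth.
have HX' : {in drop i.+1 X, forall y, 0 < y < n.+1} by move=> y /mem_drop /HX.
rewrite /gf_step -/x; set U := fun k => _; set vs := topkeys U T.
have Hc : chain (step f t x) t (drop i.+1 X) 0 n.+1 vs (hang U T).
  apply: (chain_topkeys _ _ _ HT) => // q Hq; first by rewrite Hx.
  by rewrite /step /U (search_path_vis HT).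
set items := [seq _ | j <- iota 0 _].
have Ei : unzip1 items = vs by rewrite /unzip1 -map_comp; apply: (mkseq_nth 0 vs).
apply: (tree_inv_build (t := t) (base := i.+1)) => //.
- by move=> q; apply: step_le.
- by rewrite size_map size_iota.
- by rewrite Ei.
- exact: (next_query_ok_tau (fun k => index (nth 0 vs k) (search_path x T)) HX' (j := 0)).
Qed.

Lemma count_vis_le_path f x rest n T :
  tree_inv f (x :: rest) 0 n.+1 T -> 0 < x < n.+1 ->
  count (vis f x) (iota 1 n) <= size (search_path x T).
Proof.
move=> HT Hx; rewrite -size_filter; apply: uniq_leq_size.
  by apply: filter_uniq; apply: iota_uniq.
move=> p; rewrite mem_filter mem_iota => /andP [Hv Hp].
by rewrite (search_path_vis HT) //; lia.
Qed.

Lemma greedy_cost_le_gf_run f t n X i T :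
  {in X, forall y, 0 < y < n.+1} -> (forall q, f q < t) ->
  tree_inv f (drop i X) 0 n.+1 T ->
  greedy_cost n f t (drop i X) <= gf_run X i T (drop i X).
Proof.
move=> HX; move: {2}(size X - i) (erefl (size X - i)) => m.
elim: m i f t T => [|m IH] i f t T Hm lt_ft HT.
  by rewrite drop_oversize //; lia.
have lt_i : i < size X by lia.
have HT' := tree_inv_gf_step HX lt_i lt_ft HT.
move: HT; rewrite (drop_nth 0) //= => HT.
apply: leq_add; first by apply: count_vis_le_path HT _; apply: HX; apply: mem_nth.
by apply: IH => //; [lia | move=> q; rewrite ltnS; apply: step_le].
Qed.

(** * Touch times for the initial tree *)

Fixpoint tree_height (T : tree) : nat :=
  if T is Node l _ r then (maxn (tree_height l) (tree_height r)).+1 else 0.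

(* Any strictly decreasing function of the depth would represent the initial tree. *)
Fixpoint initial_touch (b : nat) (T : tree) (q : nat) : nat :=
  if T is Node l k r then
    if q == k then b else
    if q < k then initial_touch b.-1 l q else initial_touch b.-1 r q
  else 0.

Lemma initial_touch_le b T q : initial_touch b T q <= b.
Proof.
elim: T b => [|l IHl k r IHr] b //=.
case: ifP => // _; case: ifP => _; apply: leq_trans (leq_pred b); auto.
Qed.

Lemma iota_cat_cons a m s1 k s2 :
  s1 ++ k :: s2 = iota a m ->
  [/\ k = a + size s1, s1 = iota a (size s1), s2 = iota k.+1 (size s2) & m = size s1 + (size s2).+1].
Proof.
elim: s1 a m => [|x s1 IH] a [|m] //=.
  by case=> -> E; split; rewrite ?addn0 ?E ?size_iota.
case=> -> /IH [Ek E1 E2 ->]; split; rewrite ?addSn ?addnS ?Ek //; last by rewrite -Ek.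
by rewrite /= -E1.
Qed.

(** Keys below a root get strictly smaller values, so the root is visible from its whole interval,
    whatever the queries. The bound on the height keeps [b.-1] from truncating. *)
Lemma tree_inv_initial b T f rest lo hi :
  inorder T = iota lo.+1 (hi - lo.+1) -> tree_height T <= b -> lo < hi ->
  (forall q, lo < q < hi -> f q = initial_touch b T q) ->
  tree_inv f rest lo hi T.
Proof.
elim: T b lo hi => [|l IHl k r IHr] b lo hi /=.
  by move=> /(congr1 size); rewrite size_iota /=; lia.
move=> /iota_cat_cons [Ek El Er Em] Hb lt_lo Hf.
have Hlt q : lo < q < hi -> q != k -> f q < f k.
  move=> Hq neq_qk; rewrite !Hf ?eqxx ?(negPf neq_qk); try lia.
  by case: ifP => _; apply: leq_ltn_trans (initial_touch_le _ _ _) _; lia.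
split; first by lia.
- by move=> q Hq; case: (eqVneq q k) => [->|/(Hlt q Hq)/ltnW].
- move=> y Hy; have : y \in [seq y <- rest | lo < y < hi].
    by case: [seq _ <- _ | _] Hy => [|z s] //= [->]; rewrite mem_head.
  by rewrite mem_filter => /andP [Hyr _]; apply/visP => q Hq; apply: Hlt; lia.
- apply: (IHl b.-1); [rewrite {1}El | lia | lia |].
  + by congr iota; lia.
  + move=> q Hq; rewrite Hf; last lia.
    by rewrite ifN ?ifT //; lia.
- apply: (IHr b.-1); [rewrite {1}Er | lia | lia |].
  + by congr iota; lia.
  + move=> q Hq; rewrite Hf; last lia.
    by rewrite ifN ?ifN //; lia.
Qed.

Lemma greedy_cost_le_gf_cost n T0 X :
  is_bst n T0 -> {in X, forall y, 0 < y < n.+1} ->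
  exists f t, (forall q, f q < t) /\ greedy_cost n f t X <= gf_cost X T0.
Proof.
move=> HT0 HX; exists (initial_touch (tree_height T0) T0), (tree_height T0).+1.
have Hlt q : initial_touch (tree_height T0) T0 q < (tree_height T0).+1.
  by rewrite ltnS; apply: initial_touch_le.
split=> //; have := @greedy_cost_le_gf_run _ _ n X 0 T0 HX Hlt; rewrite drop0; apply.
by apply: (@tree_inv_initial (tree_height T0)) => //; rewrite HT0 subn1.
Qed.

(** * Four separators around five groups *)

Lemma step_self f t x : step f t x x = t.
Proof. by rewrite /step vis_refl. Qed.

Lemma step_hidden f t x p q :
  (p < q <= x) || (x <= q < p) -> f p <= f q -> step f t x p = f p.
Proof. by move=> Hq le_pq; rewrite /step (visN Hq). Qed.

Lemma step_seen f t x p :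
  (forall q, (p < q <= x) || (x <= q < p) -> f q < f p) -> step f t x p = t.
Proof. by move=> /visP Hp; rewrite /step Hp. Qed.

Lemma locate o m q : o < q < o + 5 * m ->
  exists2 i, i < 5 & (0 < i /\ q = o + i * m) \/ o + i * m < q < o + i.+1 * m.
Proof.
move=> Hq; have m_gt0 : 0 < m by case: m Hq => //; lia.
have lt_d5 : (q - o) %/ m < 5 by rewrite ltn_divLR //; lia.
have := divn_eq (q - o) m; have := ltn_pmod (q - o) m_gt0.
move: (_ %/ m) (_ %% m) lt_d5 => d r lt_d5 lt_rm E; exists d => //.
case: (posnP r) => [r0|r_gt0]; [left|right; rewrite mulSn; lia].
by split; [rewrite lt0n; apply/eqP => d0; move: E; rewrite d0; lia | lia].
Qed.

Section Separators.
Variables (f h B : nat -> nat) (o m g x : nat).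
Hypotheses
  (f_sep : forall j, 0 < j < 5 -> f (o + j * m) = h j)
  (f_group : forall i q, i < 5 -> o + i * m < q < o + i.+1 * m -> f q <= B i)
  (B_left : forall i, 0 < i < 5 -> B i <= h i)
  (B_right : forall i, i < 4 -> B i <= h i.+1)
  (Bg_left : 0 < g -> B g < h g) (Bg_right : g < 4 -> B g < h g.+1)
  (g_lt5 : g < 5) (x_group : o + g * m < x < o + g.+1 * m).

(** Group keys between the separator and [x] are no more recent than a separator bordering their
    group, so only separators need comparing. In group [g] that border may be the separator under
    test, hence the strict bounds there. *)
Lemma vis_sep_left j : 0 < j <= g ->
  vis f x (o + j * m) = all (fun i => h i < h j) (iota j.+1 (g - j)).
Proof.
move=> Hj; have m_gt0 : 0 < m by rewrite lt0n; apply/eqP => E; move: x_group; rewrite E; lia.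
apply/visP/allP => [Hv i|Hall q Hq].
  rewrite mem_iota => Hi; rewrite -!f_sep; try lia.
  apply: Hv; have : i * m <= g * m by rewrite leq_mul2r; lia.
  by have : j * m < i * m; [rewrite ltn_mul2r; lia | lia].
have le_jg : j * m <= g * m by rewrite leq_mul2r; lia.
have [|i lt_i5 Hi] := @locate o m q.
  have : g.+1 * m <= 5 * m by rewrite leq_mul2r; lia.
  by have := leq0n (j * m); lia.
have Hall' k : j < k <= g -> h k < h j.
  by move=> Hk; apply: Hall; rewrite mem_iota; lia.
rewrite f_sep; last lia.
have le_ig : i <= g.
  rewrite leqNgt; apply/negP => lt_gi.
  by have : g.+1 * m <= i * m; [rewrite leq_mul2r; lia | lia].
have le_ji : j <= i.
  rewrite leqNgt; apply/negP => lt_ij.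
  by have : i.+1 * m <= j * m; [rewrite leq_mul2r; lia | lia].
case: Hi => [[i_gt0 Eq]|Hi].
  rewrite Eq f_sep; last lia.
  have : i != j by apply/eqP => Eij; move: Hq; rewrite Eq Eij; lia.
  by move=> neq_ij; apply: Hall'; lia.
apply: leq_ltn_trans (f_group lt_i5 Hi) _.
case: (eqVneq i g) => [->|neq_ig].
  case: (eqVneq g j) => [<-|neq_gj]; first by apply: Bg_left; lia.
  by apply: leq_trans (Bg_left _) _; [lia | apply: ltnW; apply: Hall'; lia].
case: (eqVneq i j) => [Eij|neq_ij].
  by apply: leq_ltn_trans (B_right _) _; [lia | rewrite Eij; apply: Hall'; lia].
by apply: leq_ltn_trans (B_left _) _; [lia | apply: Hall'; lia].
Qed.

Lemma vis_sep_right j : g < j < 5 ->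
  vis f x (o + j * m) = all (fun i => h i < h j) (iota g.+1 (j - g.+1)).
Proof.
move=> Hj; have m_gt0 : 0 < m by rewrite lt0n; apply/eqP => E; move: x_group; rewrite E; lia.
apply/visP/allP => [Hv i|Hall q Hq].
  rewrite mem_iota => Hi; rewrite -!f_sep; try lia.
  apply: Hv; have : g.+1 * m <= i * m by rewrite leq_mul2r; lia.
  by have : i * m < j * m; [rewrite ltn_mul2r; lia | lia].
have le_jg : g.+1 * m <= j * m by rewrite leq_mul2r; lia.
have [|i lt_i5 Hi] := @locate o m q.
  have : j * m <= 5 * m by rewrite leq_mul2r; lia.
  by have := leq0n (g * m); lia.
have Hall' k : g < k < j -> h k < h j.
  by move=> Hk; apply: Hall; rewrite mem_iota; lia.
rewrite f_sep; last lia.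
have le_gi : g <= i.
  rewrite leqNgt; apply/negP => lt_ig.
  by have : i.+1 * m <= g * m; [rewrite leq_mul2r; lia | lia].
have le_ij : i <= j.
  rewrite leqNgt; apply/negP => lt_ji.
  by have : j.+1 * m <= i * m; [rewrite leq_mul2r; lia | lia].
case: Hi => [[i_gt0 Eq]|Hi].
  rewrite Eq f_sep; last lia.
  have : i != j by apply/eqP => Eij; move: Hq; rewrite Eq Eij; lia.
  have : i != g by apply/eqP => Eij; move: Hq; rewrite Eq Eij; lia.
  by move=> neq_ig neq_ij; apply: Hall'; lia.
have neq_ij : i != j by apply/eqP => Eij; move: Hq Hi; rewrite Eij; lia.
apply: leq_ltn_trans (f_group lt_i5 Hi) _.
case: (eqVneq i g) => [->|neq_ig].
  case: (eqVneq j g.+1) => [->|neq_gj]; first by apply: Bg_right; lia.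
  by apply: leq_trans (Bg_right _) _; [lia | apply: ltnW; apply: Hall'; lia].
by apply: leq_ltn_trans (B_left _) _; [lia | apply: Hall'; lia].
Qed.

(** The separator at the end of group [i] facing [x] hides the whole group. *)
Lemma vis_other_group i q : i < 5 -> i != g -> o + i * m < q < o + i.+1 * m ->
  vis f x q = false.
Proof.
move=> lt_i5 neq_ig Hq; have le_q := f_group lt_i5 Hq.
case: (ltngtP i g) neq_ig => // Hig _.
  have : i.+1 * m <= g * m by rewrite leq_mul2r; lia.
  move=> le_ig; apply: (@visN _ _ _ (o + i.+1 * m)); first by lia.
  by rewrite f_sep ?(leq_trans le_q) ?B_right //; lia.
have : g.+1 * m <= i * m by rewrite leq_mul2r; lia.
move=> le_gi; apply: (@visN _ _ _ (o + i * m)); first by lia.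
by rewrite f_sep ?(leq_trans le_q) ?B_left //; lia.
Qed.

End Separators.

(* What holds after the first [k] queries of a pass [s1 s1 s2 s2 s3 s3 s4] over
   the separators of the block [(o, e)], whatever the state before the pass. *)
Definition setup_state (k : nat) (o e s1 s2 s3 s4 : nat) (f : nat -> nat) : Prop :=
  match k with
  | 0 => True
  | 1 => forall q, o < q < e -> f q <= f s1
  | 2 => forall q, o < q < e -> q != s1 -> f q < f s1
  | 3 => f s1 = f s2 /\ forall q, o < q < e -> f q <= f s1
  | 4 => f s1 < f s2 /\ forall q, o < q < e -> q != s2 -> f q <= f s1
  | 5 => [/\ f s1 < f s2, f s2 = f s3, forall q, o < q < s2 -> f q <= f s1 &
             forall q, o < q < e -> f q <= f s2]
  | 6 => [/\ f s1 < f s2, f s2 < f s3, forall q, o < q < s2 -> f q <= f s1 &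
             forall q, o < q < e -> q != s3 -> f q <= f s2]
  | _ => [/\ f s1 < f s2 < f s3, f s3 = f s4, forall q, o < q < s2 -> f q <= f s1,
             forall q, o < q < s3 -> f q <= f s2 &
             forall q, o < q < e -> f q <= f s3]
  end.

Lemma step_top f t o e x p :
  (forall q, o < q < e -> f q <= f x) -> o < x < e -> o < p < e -> p != x -> step f t x p = f p.
Proof.
move=> Hx Hxe Hp neq; apply: (@step_hidden _ _ _ _ x); last exact: Hx.
by lia.
Qed.

(** A first query to [s2], [s3] or [s4] also touches the previous separator, which was strictly most
    recent. The resulting tie hides the latter from the repeated query, which makes the new
    separator strictly latest. The single query to [s4] leaves [s3] and [s4] tied. *)
Lemma setup_state_step k o e s1 s2 s3 s4 f t :
  o < s1 -> s1 < s2 -> s2 < s3 -> s3 < s4 -> s4 < e -> k < 7 ->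
  (forall q, f q < t) -> setup_state k o e s1 s2 s3 s4 f ->
  setup_state k.+1 o e s1 s2 s3 s4 (step f t (nth 0 [:: s1; s1; s2; s2; s3; s3; s4] k)).
Proof.
move=> os1 s12 s23 s34 s4e; have le_t x p : (forall q, f q < t) -> step f t x p <= t.
  by apply: step_le.
case: k => [|[|[|[|[|[|[|//]]]]]]] _ Ht /=.
- by move=> _ q Hq; rewrite step_self le_t.
- move=> H q Hq neq; rewrite step_self (step_top _ H) //; lia.
- move=> H; have E : step f t s2 s1 = t by apply: step_seen => q Hq; apply: H; lia.
  by rewrite step_self E; split=> // q _; apply: le_t.
- move=> [E H].
  have H2 q : o < q < e -> f q <= f s2 by rewrite -E; apply: H.
  rewrite step_self (step_top _ H2); try lia.
  by split=> // q Hq neq; rewrite (step_top _ H2) //; [apply: H | lia].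
- move=> [lt12 H].
  have Hs q : o < q < s2 -> step f t s3 q = f q.
    move=> Hq; apply: (@step_hidden _ _ _ _ s2); first lia.
    by apply: leq_trans (H q _ _) (ltnW lt12); lia.
  have E : step f t s3 s2 = t.
    by apply: step_seen => q Hq; apply: leq_ltn_trans (H q _ _) lt12; lia.
  rewrite step_self E Hs; last lia.
  split=> // [q Hq|q _]; last exact: le_t.
  by rewrite Hs //; apply: H; lia.
- move=> [lt12 E Hl H].
  have H3 q : o < q < e -> f q <= f s3 by rewrite -E; apply: H.
  rewrite step_self !(step_top _ H3); try lia.
  split=> // q Hq; first by rewrite (step_top _ H3); [apply: Hl | lia | lia | lia].
  by move=> neq; rewrite (step_top _ H3) //; [apply: H | lia].
- move=> [lt12 lt23 Hl H].
  have Hs q : o < q < s3 -> step f t s4 q = f q.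
    move=> Hq; apply: (@step_hidden _ _ _ _ s3); first lia.
    by apply: leq_trans (H q _ _) (ltnW lt23); lia.
  have E : step f t s4 s3 = t.
    by apply: step_seen => q Hq; apply: leq_ltn_trans (H q _ _) lt23; lia.
  rewrite step_self E !Hs; try lia.
  split=> // [|q Hq|q Hq|q _]; last exact: le_t.
  + by rewrite lt12 Ht.
  + by rewrite Hs; [apply: Hl | lia].
  + by rewrite Hs //; apply: H; lia.
Qed.

(** * The nested query stream *)

(** A block at [o] consists of the keys strictly between [o] and [o + width D]; at depth 0 this is
    the single key [o.+1]. *)
Definition width (D : nat) : nat := 2 * 5 ^ D.

Lemma width0 : width 0 = 2. Proof. by []. Qed.
Lemma widthS D : width D.+1 = 5 * width D.
Proof. by rewrite /width expnS mulnCA. Qed.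
Lemma width_gt0 D : 0 < width D. Proof. by rewrite muln_gt0 expn_gt0. Qed.

Definition pass := [:: 1; 1; 2; 2; 3; 3; 4].

Definition visit_order := [:: 0; 1; 4; 3].

(* The separators are queried in two passes, then the groups 0, 1, 4, 3 are
   visited in turn; group 2 is never visited. *)
Fixpoint query (D c o : nat) : nat :=
  if D is D'.+1 then
    if c < 14 then o + nth 0 pass (c %% 7) * width D'
    else query D' ((c - 14) %/ 4) (o + nth 0 visit_order ((c - 14) %% 4) * width D')
  else o.+1.

Lemma visit_order_lt5 j : nth 0 visit_order j < 5.
Proof. by move: j => [|[|[|[|[|j]]]]]. Qed.

Lemma pass_range k : k < 7 -> 0 < nth 0 pass k < 5.
Proof. by move: k => [|[|[|[|[|[|[|k]]]]]]]. Qed.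

Lemma query_range D c o : o < query D c o < o + width D.
Proof.
elim: D c o => [|D IH] c o; first by rewrite /= width0; lia.
rewrite /=; case: ifP => _.
  have /pass_range : c %% 7 < 7 by rewrite ltn_mod.
  move: (nth 0 pass _) => j Hj; rewrite widthS; have := width_gt0 D => w_gt0.
  have : 0 < j * width D by rewrite muln_gt0; lia.
  have : j * width D < 5 * width D by rewrite ltn_mul2r; lia.
  lia.
have := IH ((c - 14) %/ 4) (o + nth 0 visit_order ((c - 14) %% 4) * width D).
have := visit_order_lt5 ((c - 14) %% 4); move: (nth 0 visit_order _) => g lt_g5.
rewrite widthS; have : g.+1 * width D <= 5 * width D by rewrite leq_mul2r; lia.
have := leq0n (g * width D); lia.
Qed.

(** A lower bound on Greedy's cost inside the block: the separators touched in each phase, summed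
    over the levels. Setup queries are credited nothing. *)
Fixpoint touched (D c : nat) : nat :=
  if D is D'.+1 then
    if c < 14 then 0
    else nth 0 [:: 3; 2; 3; 2] ((c - 14) %% 4) + touched D' ((c - 14) %/ 4)
  else 1.

(* [t1 > t2 > t3 > t4] are the times of the last four visits to the block;
   the tables index them for the four separators and the five groups, in each
   of the four phases of the visiting order. *)
Definition sep_time (ph j : nat) : nat :=
  nth 0 (nth [::] [:: [:: 2; 1; 0; 0]; [:: 0; 0; 0; 1]; [:: 0; 0; 1; 2]; [:: 1; 0; 0; 0]] ph) j.-1.

Definition group_time (ph g : nat) : nat :=
  nth 0 (nth [::] [:: [:: 3; 2; 3; 0; 1]; [:: 0; 3; 3; 1; 2]; [:: 1; 0; 3; 2; 3]; [:: 2; 1; 3; 3; 0]] ph) g.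

Definition cyclic_state (o m ph t1 t2 t3 t4 : nat) (f : nat -> nat) : Prop :=
  [/\ t4 < t3 < t2 /\ t2 < t1,
      forall j, 0 < j < 5 -> f (o + j * m) = nth 0 [:: t1; t2; t3; t4] (sep_time ph j) &
      forall g q, g < 5 -> o + g * m < q < o + g.+1 * m ->
        f q <= nth 0 [:: t1; t2; t3; t4] (group_time ph g)].

(* During the second setup pass the keys of the groups are shielded by the
   separators, so that they keep their old times, at most [w]. *)
Definition shielded (o m k : nat) (f : nat -> nat) : Prop :=
  (forall g q, g < 5 -> o + g * m < q < o + g.+1 * m ->
     (0 < g -> f q <= f (o + g * m)) /\ (g < 4 -> f q <= f (o + g.+1 * m))) /\
  exists w, [/\ w <= f (o + 3 * m),
                forall g q, g < 5 -> o + g * m < q < o + g.+1 * m -> f q <= w &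
                forall i, i < k -> w < f (o + nth 0 pass i * m)].

(** The invariant after [c] queries to the block. The quotient [(c - 14 + (3 - j)) %/ 4] is the
    number of visits so far to the group at position [j] of the visiting order. *)
Fixpoint ready (D o : nat) (f : nat -> nat) (c : nat) : Prop :=
  if D is D'.+1 then
    let m := width D' in
    let st k := setup_state k o (o + 5 * m) (o + 1 * m) (o + 2 * m) (o + 3 * m) (o + 4 * m) f in
    if c < 7 then st c
    else if c < 14 then st (c - 7) /\ shielded o m (c - 7) f
    else (exists t1 t2 t3 t4, cyclic_state o m ((c - 14) %% 4) t1 t2 t3 t4 f) /\
         forall j, j < 4 ->
           ready D' (o + nth 0 visit_order j * m) f ((c - 14 + (3 - j)) %/ 4)
  else True.

Lemma ready0 D o f : ready D o f 0.
Proof. by case: D. Qed.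

Lemma eq_setup_state k o e s1 s2 s3 s4 f f' :
  o < s1 -> s1 < s2 -> s2 < s3 -> s3 < s4 -> s4 < e ->
  (forall q, o < q < e -> f q = f' q) ->
  setup_state k o e s1 s2 s3 s4 f -> setup_state k o e s1 s2 s3 s4 f'.
Proof.
move=> os1 s12 s23 s34 s4e eq_f.
have E1 : f s1 = f' s1 by apply: eq_f; lia.
have E2 : f s2 = f' s2 by apply: eq_f; lia.
have E3 : f s3 = f' s3 by apply: eq_f; lia.
have E4 : f s4 = f' s4 by apply: eq_f; lia.
case: k => [|[|[|[|[|[|[|k]]]]]]] /=; rewrite -?E1 -?E2 -?E3 -?E4 //.
- by move=> H q Hq; rewrite -eq_f //; apply: H.
- by move=> H q Hq; rewrite -eq_f //; apply: H.
- by case=> E H; split=> // q Hq; rewrite -eq_f //; apply: H.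
- by case=> E H; split=> // q Hq; rewrite -eq_f //; apply: H.
- by case=> E E' H H'; split=> // q Hq; rewrite -eq_f //; try lia; [apply: H | apply: H'].
- by case=> E E' H H'; split=> // q Hq; rewrite -eq_f //; try lia; [apply: H | apply: H'].
- by case=> E E' H H' H''; split=> // q Hq; rewrite -eq_f //; try lia;
    [apply: H | apply: H' | apply: H''].
Qed.

Lemma sep_range D o j : 0 < j < 5 -> o < o + j * width D < o + 5 * width D.
Proof.
move=> Hj; have w_gt0 := width_gt0 D.
have : 0 < j * width D by rewrite muln_gt0; lia.
have : j * width D < 5 * width D by rewrite ltn_mul2r; lia.
lia.
Qed.

Lemma group_range D o g q : g < 5 -> o + g * width D < q < o + g.+1 * width D ->
  o < q < o + 5 * width D.
Proof.
move=> Hg Hq; have : g.+1 * width D <= 5 * width D by rewrite leq_mul2r; lia.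
have := leq0n (g * width D); lia.
Qed.

(** Every clause reads times inside the block only; this is what keeps a group in its state while
    other groups are queried. *)
Lemma eq_ready D o f f' c :
  (forall q, o < q < o + width D -> f q = f' q) -> ready D o f c -> ready D o f' c.
Proof.
elim: D o c => [|D IH] o c // eq_f; rewrite widthS in eq_f.
have w_gt0 := width_gt0 D.
have eq_sep j : 0 < j < 5 -> f (o + j * width D) = f' (o + j * width D).
  by move=> Hj; apply: eq_f; apply: sep_range.
have eq_grp g q : g < 5 -> o + g * width D < q < o + g.+1 * width D -> f q = f' q.
  by move=> Hg Hq; apply: eq_f; apply: group_range Hq.
rewrite /=; case: ifP => _; first by apply: eq_setup_state => //; lia.
case: ifP => [lt_c|_].
  case=> H [Hs [w [Hw0 Hw1 Hw2]]]; split; first by apply: eq_setup_state H => //; lia.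
  split=> [g q Hg Hq|].
    have [H1 H2] := Hs g q Hg Hq.
    by split=> Hg'; rewrite -(eq_grp g) // -eq_sep; auto; lia.
  exists w; split=> [|g q Hg Hq|i Hi]; first by rewrite -eq_sep.
    by rewrite -(eq_grp g) //; apply: Hw1 Hq.
  by rewrite -eq_sep; [apply: Hw2 | apply: pass_range; lia].
case=> [[t1 [t2 [t3 [t4 [Ht Hs Hg]]]]] Hr]; split.
  exists t1, t2, t3, t4; split=> // [j Hj|g q Hg5 Hq]; first by rewrite -eq_sep // Hs.
  by rewrite -(eq_grp g) //; apply: Hg Hq.
move=> j Hj; apply: IH (Hr j Hj) => q Hq.
apply: (eq_grp (nth 0 visit_order j)); first exact: visit_order_lt5.
by rewrite mulSn; lia.
Qed.

Lemma count_block P o m : 0 < m ->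
  count P (iota o.+1 (5 * m).-1) =
    \sum_(g < 5) count P (iota (o + g * m).+1 m.-1) + \sum_(j < 4) P (o + j.+1 * m).
Proof.
case: m => // m _.
have -> : (5 * m.+1).-1 = m + (1 + (m + (1 + (m + (1 + (m + (1 + m))))))) by lia.
rewrite !iotaD !count_cat !big_ord_recr !big_ord0 /= !addn0 !add0n.
rewrite -!addnA.
have -> : o.+1 + m = o + 1 * m.+1 by lia.
have -> : o.+1 + (m + 1) = (o + 1 * m.+1).+1 by lia.
have -> : o.+1 + (m + (1 + m)) = o + 2 * m.+1 by lia.
have -> : o.+1 + (m + (1 + (m + 1))) = (o + 2 * m.+1).+1 by lia.
have -> : o.+1 + (m + (1 + (m + (1 + m)))) = o + 3 * m.+1 by lia.
have -> : o.+1 + (m + (1 + (m + (1 + (m + 1))))) = (o + 3 * m.+1).+1 by lia.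
have -> : o.+1 + (m + (1 + (m + (1 + (m + (1 + m)))))) = o + 4 * m.+1 by lia.
have -> : o.+1 + (m + (1 + (m + (1 + (m + (1 + (m + 1))))))) = (o + 4 * m.+1).+1 by lia.
lia.
Qed.

(** The separator bordering a group on the side of the query is at least as recent as the group's
    keys and hides them. Separator times only grow, so the shield persists, and the queried
    separator rises above [w]. *)
Lemma shielded_step D o k j f t :
  let m := width D in
  shielded o m k f -> (forall q, f q < t) -> k < 7 -> j = nth 0 pass k ->
  shielded o m k.+1 (step f t (o + j * m)).
Proof.
move=> m [Hs [w [Hw0 Hw1 Hw2]]] Ht lt_k7 Ej.
have m_gt0 : 0 < m := width_gt0 D.
have Hj : 0 < j < 5 by rewrite Ej pass_range.
have Hge p : f p <= step f t (o + j * m) p by rewrite /step; case: ifP => // _; apply: ltnW.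
have Hg g q : g < 5 -> o + g * m < q < o + g.+1 * m -> step f t (o + j * m) q = f q.
  move=> Hg Hq; have [H1 H2] := Hs g q Hg Hq.
  case: (ltnP g j) => Hgj.
    have le_gj : g.+1 * m <= j * m by rewrite leq_mul2r; lia.
    by apply: (@step_hidden _ _ _ _ (o + g.+1 * m)); [lia | apply: H2; lia].
  have le_jg : j * m <= g * m by rewrite leq_mul2r; lia.
  by apply: (@step_hidden _ _ _ _ (o + g * m)); [lia | apply: H1; lia].
split=> [g q Hg5 Hq|].
  have [H1 H2] := Hs g q Hg5 Hq; rewrite (Hg g) //.
  by split=> Hg'; [apply: leq_trans (H1 Hg') _ | apply: leq_trans (H2 Hg') _].
exists w; split=> [|g q Hg5 Hq|i].
- exact: leq_trans Hw0 _.
- by rewrite (Hg g) //; apply: Hw1 Hq.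
- rewrite ltnS leq_eqVlt => /predU1P [->|lt_ik]; last by apply: leq_trans (Hw2 i lt_ik) _.
  by rewrite -Ej step_self; apply: leq_ltn_trans Hw0 _.
Qed.

Definition sep_touched (ph j : nat) : bool :=
  nth false (nth [::] [:: [:: true; true; true; false]; [:: true; true; false; false];
                          [:: false; true; true; true]; [:: false; false; true; true]] ph) j.-1.

Lemma ltn4_ind (P : nat -> Prop) : P 0 -> P 1 -> P 2 -> P 3 -> forall n, n < 4 -> P n.
Proof. by move=> ? ? ? ? [|[|[|[|]]]]. Qed.

Lemma ltn5_ind (P : nat -> Prop) : P 0 -> P 1 -> P 2 -> P 3 -> P 4 -> forall n, n < 5 -> P n.
Proof. by move=> ? ? ? ? ? [|[|[|[|[|]]]]]. Qed.

(** The group about to be visited has bound [t4], while its bordering separators date from [t3] or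
    later, which gives the strict inequalities. Everything else is a finite comparison of the
    tables. *)
Lemma cyclic_vis o m ph t1 t2 t3 t4 f x :
  let g := nth 0 visit_order ph in
  ph < 4 -> cyclic_state o m ph t1 t2 t3 t4 f -> o + g * m < x < o + g.+1 * m ->
  (forall j, 0 < j < 5 -> vis f x (o + j * m) = sep_touched ph j) /\
  (forall i q, i < 5 -> i != g -> o + i * m < q < o + i.+1 * m -> vis f x q = false).
Proof.
move=> g Hph [[Ht1 Ht2] Hs Hg] Hx.
pose h j := nth 0 [:: t1; t2; t3; t4] (sep_time ph j).
pose B i := nth 0 [:: t1; t2; t3; t4] (group_time ph i).
have B_left i : 0 < i < 5 -> B i <= h i.
  case/andP => i_gt0 lt_i5; rewrite /B /h {Hx Hs Hg}; move: i lt_i5 i_gt0.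
  by apply: ltn5_ind => // _; move: ph Hph @g @h @B; apply: ltn4_ind => /=; lia.
have B_right i : i < 4 -> B i <= h i.+1.
  rewrite /B /h {Hx Hs Hg}; move: i.
  by apply: ltn4_ind => //; move: ph Hph @g @h @B B_left; apply: ltn4_ind => /=; lia.
have Bg_left : 0 < g -> B g < h g.
  rewrite /B /h /g {Hx Hs Hg B_left B_right}.
  by move: ph Hph @g @h @B; apply: ltn4_ind => /=; lia.
have Bg_right : g < 4 -> B g < h g.+1.
  rewrite /B /h /g {Hx Hs Hg B_left B_right Bg_left}.
  by move: ph Hph @g @h @B; apply: ltn4_ind => /=; lia.
have g_lt5 : g < 5 := visit_order_lt5 ph.
split; last by move=> i q; apply: (vis_other_group (h := h) (B := B) (g := g)).
move=> j /andP [j_gt0 lt_j5].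
have -> : vis f x (o + j * m) = if j <= g then all (fun i => h i < h j) (iota j.+1 (g - j))
                                else all (fun i => h i < h j) (iota g.+1 (j - g.+1)).
  case: leqP => Hj.
    by apply: (vis_sep_left (B := B)); rewrite ?j_gt0.
  by apply: (vis_sep_right (B := B)); rewrite ?Hj.
rewrite /h /g {Hs Hg B_left B_right Bg_left Bg_right Hx g_lt5}.
move: j lt_j5 j_gt0; apply: ltn5_ind => // _.
all: by move: ph Hph @g @h @B; apply: ltn4_ind; rewrite /sep_touched /=; lia.
Qed.

(** Touched separators and the visited group move to [t]; other times stay, so their place in the
    list moves down by one. A bound [t4] relaxes to [t3], the new last entry. *)
Lemma cyclic_step o m ph t1 t2 t3 t4 f x t :
  let g := nth 0 visit_order ph in
  ph < 4 -> cyclic_state o m ph t1 t2 t3 t4 f -> o + g * m < x < o + g.+1 * m ->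
  (forall q, f q < t) ->
  cyclic_state o m (ph.+1 %% 4) t t1 t2 t3 (step f t x).
Proof.
move=> g Hph Hc Hx Ht; have [Hvs Hvg] := cyclic_vis Hph Hc Hx.
case: Hc => [[Ht1 Ht2] Hs Hg].
have lt_t1 : t1 < t.
  (* In each phase some separator carries the time [t1]. *)
  have [j Hj Ej] : exists2 j, 0 < j < 5 & sep_time ph j = 0.
    by move: ph Hph {g Hx Hvs Hvg Hs Hg}; apply: ltn4_ind;
      [exists 3 | exists 1 | exists 1 | exists 2].
  by have := Ht (o + j * m); rewrite Hs // Ej.
split; first by split=> //; lia.
- move=> j Hj; rewrite /step Hvs // Hs //.
  case/andP: Hj => j_gt0 lt_j5; move: j lt_j5 j_gt0.
  by move: ph Hph {g Hx Hvs Hvg Hs Hg}; apply: ltn4_ind; apply: ltn5_ind.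
- move=> i q lt_i5 Hq; case: (eqVneq i g) => [Eig|neq_ig].
    have -> : group_time (ph.+1 %% 4) i = 0.
      by rewrite Eig /g; move: ph Hph {g Hx Hvs Hvg Hs Hg Eig}; apply: ltn4_ind.
    exact: step_le.
  rewrite /step (Hvg i) //; apply: leq_trans (Hg _ _ lt_i5 Hq) _.
  move: i lt_i5 neq_ig {Hq}; rewrite /g {Hvs Hvg Hs Hg Hx}.
  by move: ph Hph @g; apply: ltn4_ind; apply: ltn5_ind => //= _; lia.
Qed.

Lemma nth_pass (F : nat -> nat) k : k < 7 ->
  nth 0 [:: F 1; F 1; F 2; F 2; F 3; F 3; F 4] k = F (nth 0 pass k).
Proof. by move: k; do 7 case=> //. Qed.

Lemma setup_step D o f t k :
  let m := width D in
  let st k := setup_state k o (o + 5 * m) (o + 1 * m) (o + 2 * m) (o + 3 * m) (o + 4 * m) in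
  k < 7 -> (forall q, f q < t) -> st k f ->
  st k.+1 (step f t (o + nth 0 pass k * m)).
Proof.
move=> m st lt_k7 Ht Hst; have m_gt0 : 0 < m := width_gt0 D.
rewrite -(nth_pass (fun j => o + j * m)) //.
by apply: setup_state_step => //; lia.
Qed.

Lemma shielded_of_setup D o f :
  let m := width D in
  setup_state 7 o (o + 5 * m) (o + 1 * m) (o + 2 * m) (o + 3 * m) (o + 4 * m) f ->
  shielded o m 0 f.
Proof.
move=> m [/andP [lt12 lt23] E34 H1 H2 H3].
have m_gt0 : 0 < m := width_gt0 D.
split; last first.
  (* After a full pass the third separator has the latest time of the block, so it bounds all
     groups. *)
  exists (f (o + 3 * m)); split=> // g q Hg Hq; apply: H3.
  exact: group_range Hg Hq.
move=> g q Hg; move: g Hg; apply: ltn5_ind => Hq; split=> // _.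
- by apply: H1; lia.
- by apply: H1; lia.
- by apply: leq_trans (H1 _ _) (ltnW lt12); lia.
- by apply: H2; lia.
- by apply: leq_trans (H2 _ _) (ltnW lt23); lia.
- by apply: H3; lia.
- by rewrite -E34; apply: H3; lia.
- by rewrite -E34; apply: H3; lia.
Qed.

Lemma cyclic_of_setup D o f :
  let m := width D in
  setup_state 7 o (o + 5 * m) (o + 1 * m) (o + 2 * m) (o + 3 * m) (o + 4 * m) f ->
  shielded o m 7 f ->
  exists t1 t2 t3 t4, cyclic_state o m 0 t1 t2 t3 t4 f.
Proof.
move=> m [/andP [lt12 lt23] E34 _ _ _] [_ [w [_ Hw Hs]]].
(* The last two separators tie at [t1]; the old bound [w] on the groups serves as [t4]. *)
exists (f (o + 3 * m)), (f (o + 2 * m)), (f (o + 1 * m)), w.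
have lt_w1 := Hs 0 isT; rewrite [nth _ _ _]/= in lt_w1.
split; first by rewrite lt_w1 lt12.
- move=> j /andP [j_gt0 lt_j5]; move: j lt_j5 j_gt0.
  by apply: ltn5_ind => //= _; rewrite E34.
- move=> g q Hg Hq; apply: leq_trans (Hw _ _ Hg Hq) _.
  by move: g Hg {Hq}; apply: ltn5_ind => //=; lia.
Qed.

(** In the cyclic regime the visible keys include the separators given by [cyclic_vis] and, by
    induction, those inside the visited group. The other groups are not touched, so [eq_ready]
    applies to them. *)
Lemma ready_step D o f c t :
  ready D o f c -> (forall q, f q < t) ->
  ready D o (step f t (query D c o)) c.+1 /\
  touched D c <= count (vis f (query D c o)) (iota o.+1 (width D).-1).
Proof.
elim: D o c => [|D IH] o c; first by rewrite /= vis_refl.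
have w_gt0 := width_gt0 D; rewrite widthS count_block //; set m := width D.
move=> Hr Ht; move: Hr; rewrite [ready _ _ _ _]/= [query _ _ _]/= [touched _ _]/= -/m.
case: (ltnP c 7) => [lt_c7|le_7c].
  have lt_c14 : c < 14 by lia.
  rewrite lt_c14 modn_small // => Hst; split=> //.
  have {}Hst := setup_step lt_c7 Ht Hst.
  rewrite /=; case: ltnP => [//|le_7c]; have E : c = 6 by lia.
  rewrite E in Hst *; split=> //.
  exact: shielded_of_setup Hst.
case: ltnP => [lt_c14|le_14c].
  have -> : c %% 7 = c - 7 by lia.
  have lt_c7 : c - 7 < 7 by lia.
  case=> Hst Hsh; split=> //.
  have {}Hst := setup_step lt_c7 Ht Hst.
  have {}Hsh := shielded_step Hsh Ht lt_c7 erefl.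
  rewrite /= ifN; last by lia.
  have E : c.+1 - 7 = (c - 7).+1 by lia.
  case: ltnP => [lt_c|le_c]; first by rewrite E.
  have E13 : c = 13 by lia.
  rewrite E13 in Hst Hsh *; split; first exact: cyclic_of_setup Hst Hsh.
  (* When setup ends no group has been visited, so all visit counts are 0. *)
  by move=> j Hj; rewrite divn_small; [apply: ready0 | lia].
rewrite [ready D.+1 _ _ _]/= -/m.
have -> : (c.+1 < 7) = false by lia.
have -> : (c.+1 < 14) = false by lia.
have -> : c.+1 - 14 = (c - 14).+1 by lia.
move: (c - 14) => {le_7c le_14c} {}c.
set ph := c %% 4; set k := c %/ 4.
have Hph : ph < 4 by rewrite ltn_mod.
set g := nth 0 visit_order ph => - [[t1 [t2 [t3 [t4 Hc]]]] Hr].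
set x := query D k (o + g * m).
have Hx : o + g * m < x < o + g.+1 * m.
  by have := query_range D k (o + g * m); rewrite -/m mulSn; lia.
have [Hvs Hvg] := cyclic_vis Hph Hc Hx.
have Hrg : ready D (o + g * m) f k.
  have := Hr ph Hph; rewrite -/g; congr ready.
  by rewrite /k /ph; lia.
have [Hr' Hcnt] := IH (o + g * m) k Hrg Ht; rewrite -/x in Hr' Hcnt.
split; last first.
  rewrite addnC leq_add //.
    have Hg5 : g < 5 := visit_order_lt5 ph.
    by rewrite (bigD1 (Ordinal Hg5)) //=; apply: leq_trans Hcnt (leq_addr _ _).
  rewrite !big_ord_recr big_ord0 /= !Hvs //.
  by move: ph Hph {g Hx Hvs Hvg Hc x Hrg Hr' Hcnt}; apply: ltn4_ind.
split.
  exists t, t1, t2, t3; have -> : c.+1 %% 4 = ph.+1 %% 4 by rewrite /ph; lia.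
  exact: cyclic_step Hc Hx Ht.
move=> j Hj; case: (eqVneq j ph) => [->|neq_j].
  rewrite -/g; have -> : (c.+1 + (3 - ph)) %/ 4 = k.+1 by rewrite /k /ph; lia.
  by [].
have -> : (c.+1 + (3 - j)) %/ 4 = (c + (3 - j)) %/ 4 by move: neq_j; rewrite /ph; lia.
apply: eq_ready (Hr j Hj) => q Hq; rewrite /step (Hvg (nth 0 visit_order j)) //.
- exact: visit_order_lt5.
- rewrite -/g /g; move: j Hj neq_j {Hq}.
  by move: ph Hph {g Hx Hvs Hvg Hc x Hrg Hr' Hcnt}; apply: ltn4_ind; apply: ltn4_ind.
- by rewrite mulSn -/m; move: Hq; rewrite -/m; lia.
Qed.

Lemma greedy_cost_ge n D f t c L :
  width D <= n.+1 -> ready D 0 f c -> (forall q, f q < t) ->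
  \sum_(c <= i < c + L) touched D i <= greedy_cost n f t [seq query D i 0 | i <- iota c L].
Proof.
move=> le_n; elim: L f t c => [|L IH] f t c Hr Ht; first by rewrite addn0 big_geq.
have [Hr' Hcnt] := ready_step Hr Ht.
rewrite big_ltn /=; last by lia.
apply: leq_add.
  apply: leq_trans Hcnt _; have w_gt0 := width_gt0 D.
  have -> : n = (width D).-1 + (n - (width D).-1) by lia.
  by rewrite iotaD count_cat leq_addr.
by rewrite -addSnnS; apply: IH => // q; rewrite ltnS; apply: step_le.
Qed.

(** * The static tree and the gap *)

Fixpoint static_tree (D o : nat) : tree :=
  if D is D'.+1 then
    let m := width D' in
    let sub j := static_tree D' (o + j * m) in
    Node (Node (sub 0) (o + 1 * m) (sub 1)) (o + 2 * m)
         (Node (Node (sub 2) (o + 3 * m) (sub 3)) (o + 4 * m) (sub 4))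
  else Node Leaf o.+1 Leaf.

Fixpoint static_depth (D c : nat) : nat :=
  if D is D'.+1 then
    if c < 14 then 3
    else nth 0 [:: 2; 2; 2; 3] ((c - 14) %% 4) + static_depth D' ((c - 14) %/ 4)
  else 1.

Lemma inorder_static_tree D o : inorder (static_tree D o) = iota o.+1 (width D).-1.
Proof.
elim: D o => [|D IH] o //; rewrite widthS /= !IH.
have := width_gt0 D; move: (width D) => [|m] // _.
have -> : (5 * m.+1).-1 = m + (m + (m + (m + m.+1).+1).+1).+1 by lia.
rewrite !iotaD /= !iotaD /= !iotaD /= !iotaD /=.
rewrite -?catA /= -?catA /=.
have E0 : o + 0 * m.+1 = o by lia.
have E1 : o.+1 + m = o + 1 * m.+1 by lia.
have E2 : (o.+1 + m).+1 + m = o + 2 * m.+1 by lia.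
have E3 : ((o.+1 + m).+1 + m).+1 + m = o + 3 * m.+1 by lia.
have E4 : (((o.+1 + m).+1 + m).+1 + m).+1 + m = o + 4 * m.+1 by lia.
by rewrite E4 E3 E2 E1 E0.
Qed.

Lemma search_path_static_tree D c o :
  size (search_path (query D c o) (static_tree D o)) <= static_depth D c.
Proof.
elim: D c o => [|D IH] c o; first by rewrite /= eqxx.
rewrite [query _ _ _]/= [static_depth _ _]/=.
have m_gt0 := width_gt0 D; case: ifP => _.
  have /pass_range : c %% 7 < 7 by rewrite ltn_mod.
  move: (nth 0 pass _) => j /andP [j_gt0 lt_j5]; move: j lt_j5 j_gt0.
  by apply: ltn5_ind => // _; rewrite /=; repeat (case: ifP => ? //=); lia.
set k := _ %/ 4; set ph := _ %% 4; set m := width D.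
have Hph : ph < 4 by rewrite ltn_mod.
have := query_range D k (o + nth 0 visit_order ph * m).
have := IH k (o + nth 0 visit_order ph * m).
move: (query D k _) => x; rewrite -/m.
have Hx g y : o + g * m < y < o + g * m + m -> o + g * m < y < o + g.+1 * m.
  by rewrite mulSn; lia.
move: ph Hph; apply: ltn4_ind; rewrite ![nth _ _ _]/= => Hs /Hx Hxg; rewrite /= -/m.
- have -> : (x == o + 2 * m) = false by lia.
  have -> : x < o + 2 * m by lia.
  have -> : (x == o + 1 * m) = false by lia.
  by have -> : x < o + 1 * m by lia.
- have -> : (x == o + 2 * m) = false by lia.
  have -> : x < o + 2 * m by lia.
  have -> : (x == o + 1 * m) = false by lia.
  by have -> : (x < o + 1 * m) = false by lia.
- have -> : (x == o + 2 * m) = false by lia.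
  have -> : (x < o + 2 * m) = false by lia.
  have -> : (x == o + 4 * m) = false by lia.
  by have -> : (x < o + 4 * m) = false by lia.
- have -> : (x == o + 2 * m) = false by lia.
  have -> : (x < o + 2 * m) = false by lia.
  have -> : (x == o + 4 * m) = false by lia.
  have -> : x < o + 4 * m by lia.
  have -> : (x == o + 3 * m) = false by lia.
  by have -> : (x < o + 3 * m) = false by lia.
Qed.

Fixpoint right_comb (a m : nat) : tree :=
  if m is m'.+1 then Node Leaf a (right_comb a.+1 m') else Leaf.

Lemma inorder_right_comb a m : inorder (right_comb a m) = iota a m.
Proof. by elim: m a => [|m IH] a //=; rewrite IH. Qed.

(** The extra root costs each query one node; the comb stores the keys above [width D], which the
    stream never queries. *)
Definition padded_tree (n D : nat) : tree :=
  Node (static_tree D 0) (width D) (right_comb (width D).+1 (n - width D)).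

Lemma inorder_padded_tree n D : width D <= n -> inorder (padded_tree n D) = iota 1 n.
Proof.
move=> le_n; rewrite /= inorder_static_tree inorder_right_comb.
have w_gt0 := width_gt0 D; have -> : n = (width D).-1 + (n - width D).+1 by lia.
rewrite iotaD /=; congr (_ ++ _); have -> : 1 + (width D).-1 = width D by lia.
by congr (_ :: iota _ _); lia.
Qed.

Lemma search_path_padded_tree n D c :
  size (search_path (query D c 0) (padded_tree n D)) <= (static_depth D c).+1.
Proof.
rewrite /=; have := query_range D c 0; rewrite add0n => Hq.
have -> : (query D c 0 == width D) = false by lia.
have -> : query D c 0 < width D by lia.
exact: search_path_static_tree.
Qed.

Lemma topkeys_predT T : topkeys predT T = inorder T.
Proof. by elim: T => [|l IHl k r IHr] //=; rewrite IHl IHr. Qed.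

Lemma hang_predT T : hang predT T = nseq (size (inorder T)).+1 Leaf.
Proof.
elim: T => [|l IHl k r IHr] //=; rewrite IHl IHr size_cat /=.
by rewrite cat_nseq; elim: (size (inorder l)) => //= a ->.
Qed.

Lemma size_search_path x T : size (search_path x T) <= size (inorder T).
Proof.
elim: T => [|l IHl k r IHr] //=; rewrite size_cat /=; case: ifP => _ /=; first by lia.
by case: ifP => _; lia.
Qed.

(** * The offline optimum and the total gap *)

Lemma ex_min_nat (P : nat -> Prop) :
  (exists c, P c) -> exists2 c, P c & forall d, P d -> c <= d.
Proof.
case=> c; elim/ltn_ind: c => c IH Pc.
case: (classic (exists2 d, d < c & P d)) => [[d lt_dc Pd]|H]; first exact: IH Pd.
exists c => // d Pd; rewrite leqNgt; apply/negP => lt_dc; apply: H; by exists d.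
Qed.

(** An offline competitor turns [T0] into [S] at the first query, paying at most [n] for the path
    and [n] for the rebuilt keys, and never rotates again. *)
Lemma opt_cost_le n T0 S x X :
  0 < n -> is_bst n T0 -> is_bst n S ->
  exists opt, is_opt_cost T0 (x :: X) opt /\
    opt <= 2 * n + sumn [seq size (search_path y S) | y <- X].
Proof.
move=> n_gt0 HT0 HS.
pose E := (S, inorder T0) :: [seq (S, [::]) | _ <- X].
have HE : valid_exec T0 (x :: X) E.
  split; last by rewrite /=; elim: X {E} => [|y X IH] //=; split=> //; constructor.
  move: HT0; case: (T0) => [|l k r] HT0; first by move: HT0 n_gt0; rewrite /is_bst /=; case: n {HS}.
  rewrite -topkeys_predT; apply: rs_top => //.
    by rewrite !topkeys_predT HS HT0.
  by rewrite !hang_predT HS HT0.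
have [|opt Hopt Hmin] := @ex_min_nat (fun c => exists E', valid_exec T0 (x :: X) E' /\ exec_cost T0 (x :: X) E' = c).
  by exists (exec_cost T0 (x :: X) E), E.
exists opt; split; first by split=> // E' HE'; apply: Hmin; exists E'.
apply: leq_trans (Hmin _ (ex_intro _ E (conj HE erefl))) _.
rewrite /E /= leq_add //.
  apply: leq_trans (size_undup _) _; rewrite size_cat mul2n -addnn.
  by have := size_search_path x T0; rewrite HT0 size_iota => H; rewrite leq_add.
elim: X {E HE Hopt Hmin} => [|y X IH] //=; apply: leq_add => //.
by rewrite cats0; apply: size_undup.
Qed.

(** Chosen so that all cycles are complete and every visited bottom block receives exactly [K]
    queries. *)
Fixpoint stream_length (K D : nat) : nat :=
  if D is D'.+1 then 14 + 4 * stream_length K D' else K.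

Lemma sum_nat4 (F : nat -> nat) m :
  \sum_(0 <= i < 4 * m) F i =
  \sum_(0 <= i < m) (F (4 * i) + F (4 * i).+1 + F (4 * i).+2 + F (4 * i).+3).
Proof.
elim: m => [|m IH]; first by rewrite !big_geq.
rewrite mulnS addnC !addnS addn0 !big_nat_recr //= IH; lia.
Qed.

Lemma sum_stream (a0 a1 a2 a3 z m : nat) (e F : nat -> nat) :
  (forall c, F c = if c < 14 then z
                   else nth 0 [:: a0; a1; a2; a3] ((c - 14) %% 4) + e ((c - 14) %/ 4)) ->
  \sum_(0 <= i < 14 + 4 * m) F i =
  14 * z + (a0 + a1 + a2 + a3) * m + 4 * \sum_(0 <= i < m) e i.
Proof.
move=> HF; rewrite (big_cat_nat (n := 14)) ?leq_addr //= -addnA; congr (_ + _).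
  rewrite (eq_big_nat _ _ (F2 := fun=> z)) ?sum_nat_const_nat // => i /andP [_ lt_i].
  by rewrite HF lt_i.
rewrite -{1}[14]add0n big_addn addKn sum_nat4 big_distrr /=.
have -> : (a0 + a1 + a2 + a3) * m = \sum_(0 <= i < m) (a0 + a1 + a2 + a3).
  by rewrite sum_nat_const_nat subn0 mulnC.
rewrite -big_split /=; apply: eq_bigr => i _.
have E j : j < 4 -> F (4 * i + j + 14) = nth 0 [:: a0; a1; a2; a3] j + e i.
  move=> Hj; rewrite HF ltnNge leq_addl /= addnK.
  have -> : (4 * i + j) %% 4 = j by lia.
  by have -> : (4 * i + j) %/ 4 = i by lia.
have := E 0 isT; have := E 1 isT; have := E 2 isT; have := E 3 isT.
rewrite !addnS !addn0 /= => -> -> -> ->; lia.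
Qed.

(** With [L] queries per group, a level costs the static tree [42 + 9 * L] and Greedy at least
    [10 * L]. The gain is [L], less the setup cost 42; the constant 56 absorbs the latter because
    [4 * 42 + 56 = 4 * 56]. *)
Lemma sum_static_le_touched K D :
  4 * (\sum_(0 <= i < stream_length K D) static_depth D i) + D * 4 ^ D * K + 56 <=
  4 * (\sum_(0 <= i < stream_length K D) touched D i) + 56 * 4 ^ D /\
  4 ^ D * K <= stream_length K D.
Proof.
elim: D => [|D [IH1 IH2]]; first by rewrite /= !mul0n mul1n; split; lia.
rewrite [stream_length _ _]/=.
rewrite (@sum_stream 3 2 3 2 0 _ (touched D) (touched D.+1)) //.
rewrite (@sum_stream 2 2 2 3 3 _ (static_depth D) (static_depth D.+1)) //.
rewrite expnS; move: IH1 IH2; move: (\sum_(_ <= _ < _) _) (\sum_(_ <= _ < _) _) => A B.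
move: (stream_length K D) => L; set W := 4 ^ D => IH1 IH2; split; last by lia.
have -> : D.+1 * (4 * W) * K = 4 * (D * W * K) + 4 * (W * K) by lia.
lia.
Qed.

Lemma stream_length_le K D : stream_length K D + 5 <= 4 ^ D * (K + 5).
Proof. by elim: D => [|D IH]; rewrite ?mul1n //= expnS -mulnA; lia. Qed.

(** On the right, [56 * 4 ^ D] accounts for the setups, [4 * stream_length K D] for the extra root
    of the padded tree and [8 * n] for the initial rebuilding. *)
Lemma gap_bound n D K T0 :
  0 < K -> width D <= n -> is_bst n T0 ->
  let X := [seq query D i 0 | i <- iota 0 (stream_length K D)] in
  exists opt, [/\ all (fun x => 1 <= x <= n) X, is_opt_cost T0 X opt &
    4 * opt + D * 4 ^ D * K <= 4 * gf_cost X T0 + 56 * 4 ^ D + 4 * stream_length K D + 8 * n].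
Proof.
move=> K_gt0 le_n HT0 X.
have HX : all (fun x => 1 <= x <= n) X.
  by apply/allP => x /mapP [i _ ->]; have := query_range D i 0; lia.
have HX' : {in X, forall y, 0 < y < n.+1} by move=> y /(allP HX); lia.
have [sum1 le_L] := sum_static_le_touched K D.
have L_gt0 : 0 < stream_length K D.
  by apply: leq_trans le_L; rewrite muln_gt0 expn_gt0.
have [f [t [Ht Hgf]]] := greedy_cost_le_gf_cost HT0 HX'.
have Hg := @greedy_cost_ge n D f t 0 (stream_length K D) (leqW le_n) (ready0 _ _ _) Ht.
rewrite add0n in Hg; have {Hg Hgf} Hgf := leq_trans Hg Hgf.
have n_gt0 : 0 < n by apply: leq_trans le_n; apply: width_gt0.
have [opt [Hopt le_opt]] : exists opt, is_opt_cost T0 X opt /\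
    opt <= 2 * n + sumn [seq size (search_path y (padded_tree n D)) | y <- X].
  rewrite /X; case: (stream_length K D) L_gt0 => // L _.
  have [opt [H1 H2]] := opt_cost_le (query D 0 0) [seq query D i 0 | i <- iota 1 L]
    n_gt0 HT0 (inorder_padded_tree le_n).
  exists opt; split; first exact: H1.
  by apply: leq_trans H2 _; rewrite leq_add2l leq_addl.
exists opt; split=> //.
have : sumn [seq size (search_path y (padded_tree n D)) | y <- X] <=
       \sum_(0 <= i < stream_length K D) static_depth D i + stream_length K D.
  rewrite /X sumnE !big_map -[X in _ <= _ + X]muln1 -[X in _ <= _ + X * _]subn0.
  rewrite -sum_nat_const_nat -big_split /= /index_iota subn0; apply: leq_sum => i _.
  by rewrite addn1; apply: search_path_padded_tree.
by move: Hgf sum1 le_opt; rewrite -/X; lia.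
Qed.

(** * Choice of depth, length and constants *)

Lemma width_le_exp10 D : 0 < D -> width D <= 10 ^ D.
Proof.
move=> D_gt0; have -> : 10 ^ D = 2 ^ D * 5 ^ D by rewrite -expnMn.
rewrite /width leq_mul2r.
by apply/orP; right; apply: (@leq_pexp2l 2 1 D).
Qed.

(** As [K] is at least [n * n], the term [D * W * K] dominates all the losses, and [L] is at most
    slightly above [W * K]. *)
Lemma gap_arith D n W K L opt gf :
  10 <= D -> 100 <= n -> 0 < W -> n * n <= K ->
  L + 5 <= W * (K + 5) ->
  4 * opt + D * W * K <= 4 * gf + 56 * W + 4 * L + 8 * n ->
  D * L + 16 * opt <= 16 * gf.
Proof.
move=> HD Hn HW HK HL Hgap.
have Hn2 : 100 * n <= n * n by rewrite leq_mul2r Hn orbT.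
have H1 : D * L <= D * (W * K) + 5 * (D * W).
  have : D * (L + 5) <= D * (W * (K + 5)) by rewrite leq_mul2l HL orbT.
  by lia.
have H2 : 1000 * (D * W) <= D * (W * K).
  have : (D * W) * 1000 <= (D * W) * K by rewrite leq_mul2l; apply/orP; right; lia.
  by lia.
have H3 : 10 * (W * K) <= D * (W * K) by rewrite leq_mul2r HD orbT.
have H4 : 100 * n <= W * K.
  apply: leq_trans (leq_trans Hn2 HK) _; by rewrite leq_pmull.
have H5 : 10 * W <= D * W by rewrite leq_mul2r HD orbT.
lia.
Qed.

Local Open Scope R_scope.

Lemma INR_expn (a j : nat) : INR (a ^ j)%N = INR a ^ j.
Proof. by elim: j => [|j IH] //=; rewrite expnS mult_INR IH. Qed.

Lemma ln2_gt0 : 0 < ln 2.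
Proof. by have := ln_lt_2; lra. Qed.

Lemma lg_le x y : 0 < x -> x <= y -> lg x <= lg y.
Proof.
move=> x_gt0 le_xy; apply: Rmult_le_compat_r.
  by left; apply: Rinv_0_lt_compat; apply: ln2_gt0.
by case: le_xy => [lt_xy|->]; [left; apply: ln_increasing | right].
Qed.

Lemma lg_pow x j : 0 < x -> lg (x ^ j) = INR j * lg x.
Proof. by move=> x_gt0; rewrite /lg ln_pow //; field; have := ln2_gt0; lra. Qed.

Lemma lg2 : lg 2 = 1.
Proof. by rewrite /lg; field; have := ln2_gt0; lra. Qed.

(** The tangent bound [ln y <= y - 1] at [y = x / 2], combined with [1/2 < ln 2 <= 1]. *)
Lemma lg_le_id x : 0 < x -> lg x <= x.
Proof.
move=> x_gt0; have l2 := ln_lt_2.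
have : ln (x / 2) <= x / 2 - 1.
  have := exp_ineq1_le (ln (x / 2)); rewrite exp_ln; lra.
rewrite /lg /Rdiv ln_mult; try lra; rewrite ln_Rinv; last lra.
move=> Hx; apply: (Rmult_le_reg_r (ln 2)); first by lra.
rewrite Rmult_assoc Rinv_l; last lra.
have l2_le1 : ln 2 <= 1 by have := exp_ineq1_le (ln 2); rewrite exp_ln; lra.
nra.
Qed.

Theorem theorem2 :
  exists c c1 c2 : R, (0 < c)%R /\ (0 < c1)%R /\ (0 < c2)%R /\
  exists N0 : nat, forall n : nat, (2 <= n)%N -> (N0 <= n)%N ->
  forall T0 : tree, is_bst n T0 ->
  exists (X : seq nat) (opt : nat),
    all (fun x => (1 <= x <= n)%N) X /\
    is_opt_cost T0 X opt /\
    (INR (gf_cost X T0) - INR opt >= c * INR (size X) * lg (lg (INR n)))%R /\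
    (c1 * (lg (lg (INR n)) / lg (lg (lg (INR n)))) * lg (INR n)
       <= lg (INR (size X)) <=
     c2 * (lg (lg (INR n)) / lg (lg (lg (INR n)))) * lg (INR n))%R.
Proof.
(* The gap is at least [D * L / 16] and [lg (lg n) <= 5 * D], whence 80. The length is at most
   [n ^ (k + 4)] with [k <= r + 1] and [1 <= r], whence 6. *)
exists (/ 80), 1, 6; do 3 (split; first by lra).
(* This threshold yields [10 <= D], as [gap_arith] requires. *)
exists (10 ^ 10)%N => n n_ge2 Hn T0 HT0.
have n_ge100 : (100 <= n)%N by apply: leq_trans Hn; apply: (@leq_pexp2l 10 2 10).
have n_gt0 : (0 < n)%N by apply: leq_trans n_ge2.
pose D := trunc_log 10 n.
have HD : (10 <= D)%N by have := leq_trunc_log 10 Hn; rewrite trunc_expnK.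
have leDn : (10 ^ D <= n)%N by apply: trunc_logP.
have ltnD : (n < 10 ^ D.+1)%N by apply: trunc_log_ltn.
have lewn : (width D <= n)%N by apply: leq_trans (width_le_exp10 _) leDn; apply: leq_trans HD.
have leWn : (4 ^ D <= n)%N by apply: leq_trans leDn; rewrite leq_exp2r //; apply: leq_trans HD.
have W_gt0 : (0 < 4 ^ D)%N by rewrite expn_gt0.
set x := INR n.
have x_ge16 : 2 ^ 4 <= x.
  have -> : 2 ^ 4 = INR 16 by rewrite /=; lra.
  by apply: le_INR; apply/leP; apply: leq_trans n_ge100.
have x_gt0 : 0 < x by move: x_ge16 => /=; lra.
have lgx4 : 4 <= lg x.
  have := lg_le _ x_ge16; rewrite lg_pow ?lg2; [rewrite /=; lra | lra].
have lglgx2 : 2 <= lg (lg x).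
  have : lg (2 ^ 2) <= lg (lg x) by apply: lg_le; lra.
  by rewrite lg_pow ?lg2 /=; lra.
have lg3x1 : 1 <= lg (lg (lg x)) by rewrite -lg2; apply: lg_le; lra.
set r := lg (lg x) / lg (lg (lg x)).
have r_ge1 : 1 <= r.
  apply: (Rmult_le_reg_r (lg (lg (lg x)))); first by lra.
  rewrite /r /Rdiv Rmult_assoc Rinv_l; last by lra.
  by have := @lg_le_id (lg (lg x)); lra.
have [k Hk] : exists k : nat, r <= INR k <= r + 1.
  have [H1 H2] := archimed r.
  exists (Z.to_nat (up r)); rewrite INR_IZR_INZ Z2Nat.id; first by lra.
  by apply: le_IZR; lra.
(* The exponent [k] is the prescribed ratio [r] rounded up; the additional 2 ensures
   [n * n <= K]. *)
pose K := (n ^ (k + 2))%N.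
have HK : (n * n <= K)%N by rewrite /K expnD leq_pmull // expn_gt0 n_gt0.
have K_gt0 : (0 < K)%N by rewrite expn_gt0 n_gt0.
have [opt [HX Hopt Hgap]] := gap_bound K_gt0 lewn HT0.
set X := [seq _ | i <- _] in HX Hopt Hgap.
have sizeX : size X = stream_length K D by rewrite size_map size_iota.
have [_ leL] := sum_static_le_touched K D.
have leL' := stream_length_le K D.
exists X, opt; split=> //; split=> //; rewrite sizeX.
move: (stream_length K D) Hgap leL leL' => L Hgap leL leL'.
have {}Hgap := gap_arith HD n_ge100 W_gt0 HK leL' Hgap.
split.
  have : INR D * INR L + 16 * INR opt <= 16 * INR (gf_cost X T0).
    have -> : 16 = INR 16 by rewrite /=; lra.
    by rewrite -!mult_INR -plus_INR; apply: le_INR; apply/leP.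
  (* From [n < 10 ^ D.+1 <= 16 ^ D.+1] one gets [lg n <= 4 * (D + 1)], which is at most [5 * D] once
     [4 <= D]. *)
  have lgx_le : lg x <= 5 * INR D.
    have x_le : x <= (2 ^ 4) ^ D.+1.
      have -> : (2 ^ 4) = INR 16 by rewrite /=; lra.
      rewrite -INR_expn; apply: le_INR; apply/leP; apply: leq_trans (ltnW ltnD) _.
      by rewrite leq_exp2r.
    have := lg_le x_gt0 x_le; rewrite -pow_mult lg_pow ?lg2; last lra.
    rewrite mult_INR (S_INR D); have : 4 <= INR D.
      by have -> : 4 = INR 4 by [rewrite /=; lra]; apply: le_INR; apply/leP; apply: leq_trans HD.
    have -> : INR 4 = 4 by rewrite /=; lra.
    by lra.
  have L_ge0 : 0 <= INR L := pos_INR L.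
  (* The gap is of order [L * lg n]; [lg_le_id] weakens it to the stated order. *)
  have : lg (lg x) <= 5 * INR D by apply: Rle_trans (lg_le_id _) lgx_le; lra.
  by move=> lglg_le; nra.
have lgn j : lg (INR (n ^ j)%N) = INR j * lg x by rewrite INR_expn lg_pow.
have leKL : (n ^ (k + 2) <= L)%N by apply: leq_trans leL; rewrite leq_pmull.
have leLK : (L <= n ^ (k + 4))%N.
  (* One factor [n] covers [4 ^ D], the other covers [K + 5 <= n * K]. *)
  have -> : (n ^ (k + 4) = n * (n * K))%N by rewrite /K -!expnS !addnS.
  apply: leq_trans (leq_trans (leq_addr 5 L) leL') _.
  apply: leq_mul => //.
  have : (100 * K <= n * K)%N by rewrite leq_mul2r n_ge100 orbT.
  by move: HK n_ge100; move: (n * K)%N (n * n)%N => a b; nia.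
have npos : 0 < INR (n ^ (k + 2))%N by apply: lt_0_INR; apply/ltP.
have h1 : lg (INR (n ^ (k + 2))%N) <= lg (INR L) by apply: lg_le => //; apply: le_INR; apply/leP.
have h2 : lg (INR L) <= lg (INR (n ^ (k + 4))%N).
  apply: lg_le; last by apply: le_INR; apply/leP.
  by apply: lt_0_INR; apply/ltP; apply: leq_trans leKL.
rewrite !lgn !plus_INR in h1 h2; rewrite /= in h1 h2.
by split; nra.
Qed.
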